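(* Let $X=\{x\}$ be a one-element set. Then the $(X\cup\overline{X^+})$-generated birestriction monoid $$\mathcal F_{\varnothing}=\mathrm{BRestr}\langle X\cup\overline{X^+}\mid \overline{x}\ge x,\ \ \overline{uv}\ge\overline{u}\,\overline{v}\ (u,v\in X^+)\rangle$$ does not admit a geometric model.
   Context: A birestriction monoid is an algebra $(S;\cdot,{}^*,{}^+,1)$ such that $(S;\cdot,1)$ is a monoid and for all $x,y$: $xx^*=x$, $x^*y^*=y^*x^*$, $(xy^* )^*=x^*y^*$, $x^*y=y(xy)^*$; $x^+x=x$, $x^+y^+=y^+x^+$, $(x^+y)^+=x^+y^+$, $xy^+=(xy)^+x$; $(x^+)^*=x^+$, $(x^* )^+=x^*$. An inverse monoid is regarded as a birestriction monoid via $a^*=a^{-1}a$, $a^+=aa^{-1}$. An inverse monoid is $E$-unitary if $s\ge e$ with $e$ idempotent implies that $s$ is idempotent. $X^+$ is the free semigroup on $X$; $\overline{X^+}=\{\overline{u}:u\in X^+\}$ is a set disjoint from $X$ in bijection with $X^+$. $\mathrm{BRestr}\langle Y\mid R\rangle$ is the quotient of the free birestriction monoid on $Y$ by the congruence generated by $R$; a relation $a\ge b$ abbreviates $b=ab^*$ (equivalently $b=b^+a$). A $Y$-generated birestriction monoid $S$ admits a geometric model if there is an injective $(2,1,1,0)$-morphism (preserving $\cdot,{}^*,{}^+,1$) from $S$ into a $Y$-generated $E$-unitary inverse monoid which is $Y$-canonical, i.e. commutes with the assignment maps from $Y$. Here $Y=X\cup\overline{X^+}$. *)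

(* Defs.v *)
From HB Require Import structures.
From mathcomp Require Import all_boot boolp.

Set Implicit Arguments.
Unset Strict Implicit.
Unset Printing Implicit Defensive.

Local Open Scope group_scope.
Local Open Scope quotient_scope.

Reserved Notation "x ^[*]" (at level 1, left associativity, format "x ^[*]").
Reserved Notation "x ^[+]" (at level 1, left associativity, format "x ^[+]").

(* Algebras of signature (2,1,1,0) subject to no identity; terms are one
   instance, and congruences and quotients are defined at this level. *)
HB.mixin Record hasStarPlus S := {
  star : S -> S;
  plus : S -> S
}.

#[short(type="birestrSigType")]
HB.structure Definition BirestrSig := {S of hasStarPlus S & ChoiceBaseUMagma S}.

Bind Scope group_scope with BirestrSig.sort.

Notation "x ^[*]" := (star x) : group_scope.
Notation "x ^[+]" := (plus x) : group_scope.

HB.mixin Record Monoid_isBirestr S of Monoid S & BirestrSig S := {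
  mul_star : forall x : S, x * x^[*] = x;
  starC : forall x y : S, x^[*] * y^[*] = y^[*] * x^[*];
  star_mul_star : forall x y : S, (x * y^[*])^[*] = x^[*] * y^[*];
  star_ample : forall x y : S, x^[*] * y = y * (x * y)^[*];
  plus_mul : forall x : S, x^[+] * x = x;
  plusC : forall x y : S, x^[+] * y^[+] = y^[+] * x^[+];
  plus_mul_plus : forall x y : S, (x^[+] * y)^[+] = x^[+] * y^[+];
  plus_ample : forall x y : S, x * y^[+] = (x * y)^[+] * x;
  plus_star : forall x : S, (x^[+])^[*] = x^[+];
  star_plus : forall x : S, (x^[*])^[+] = x^[*]
}.

#[short(type="birestrMonoidType")]
HB.structure Definition BirestrMonoid :=
  {S of Monoid_isBirestr S & Monoid S & BirestrSig S}.

Bind Scope group_scope with BirestrMonoid.sort.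

Definition birestr_morphism (S T : birestrSigType) (f : S -> T) : Prop :=
  [/\ monoid_morphism f,
      {morph f : x / x^[*] >-> x^[*]} &
      {morph f : x / x^[+] >-> x^[+]}].

Record birestr_closed (S : birestrSigType) (P : S -> Prop) : Prop :=
  BirestrClosed {
    birestr_closed1 : P 1;
    birestr_closedM : forall x y, P x -> P y -> P (x * y);
    birestr_closed_star : forall x, P x -> P x^[*];
    birestr_closed_plus : forall x, P x -> P x^[+]
  }.

Definition birestr_generated (Y : Type) (S : birestrSigType) (i : Y -> S) :=
  forall P : S -> Prop, birestr_closed P -> (forall y, P (i y)) -> forall s, P s.

Record genBirestr (Y : Type) := GenBirestr {
  gen_sort :> birestrMonoidType;
  assign : Y -> gen_sort;
  gen_sortP : birestr_generated assign
}.

(* The order relation a >= b of a birestriction monoid. *)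
Definition natge (S : birestrSigType) (a b : S) : Prop := b = a * b^[*].

(* A relation a >= b in a presentation stands for the equation b = a * b^*. *)
Inductive natge_rel (S : birestrSigType) (G : S -> S -> Prop) : S -> S -> Prop :=
  NatgeRel a b of G a b : natge_rel G b (a * b^[*]).

Inductive cong_gen (S : birestrSigType) (R : S -> S -> Prop) : S -> S -> Prop :=
| cong_base a b of R a b : cong_gen R a b
| cong_refl a : cong_gen R a a
| cong_sym a b of cong_gen R a b : cong_gen R b a
| cong_trans a b c of cong_gen R a b & cong_gen R b c : cong_gen R a c
| cong_mul a a' b b' of cong_gen R a a' & cong_gen R b b' :
    cong_gen R (a * b) (a' * b')
| cong_star a a' of cong_gen R a a' : cong_gen R a^[*] a'^[*]
| cong_plus a a' of cong_gen R a a' : cong_gen R a^[+] a'^[+].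

Section Quotient.
Variables (S : birestrSigType) (R : S -> S -> Prop).

Definition cong_rel : rel S := fun a b => `[< cong_gen R a b >].

Lemma cong_rel_refl : reflexive cong_rel.
Proof. by move=> a; apply/asboolP; apply: cong_refl. Qed.

Lemma cong_rel_sym : symmetric cong_rel.
Proof. by move=> a b; apply/asboolP/asboolP; apply: cong_sym. Qed.

Lemma cong_rel_trans : transitive cong_rel.
Proof.
by move=> b a c /asboolP ab /asboolP bc; apply/asboolP; apply: cong_trans ab bc.
Qed.

Canonical cong_equiv :=
  EquivRel cong_rel cong_rel_refl cong_rel_sym cong_rel_trans.

Definition quot := {eq_quot cong_equiv}.
HB.instance Definition _ := Choice.on quot.
HB.instance Definition _ := EqQuotient.on quot.

Lemma quot_eqP (a b : S) : \pi_quot a = \pi_quot b <-> cong_gen R a b.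
Proof.
split=> [/eqquotP /asboolP //|ab]; by apply/eqquotP/asboolP.
Qed.

Definition quot_mul := lift_op2 quot (@mul S).
Definition quot_one := lift_cst quot (1 : S).
Definition quot_star := lift_op1 quot (@star S).
Definition quot_plus := lift_op1 quot (@plus S).

HB.instance Definition _ := hasMul.Build quot quot_mul.
HB.instance Definition _ := hasOne.Build quot quot_one.
HB.instance Definition _ := hasStarPlus.Build quot quot_star quot_plus.

Lemma repr_cong a : cong_gen R (repr (\pi_quot a)) a.
Proof. by apply/quot_eqP; rewrite reprK. Qed.

Lemma quotM a b : \pi_quot (a * b) = \pi_quot a * \pi_quot b.
Proof.
rewrite /mul /= /quot_mul -lock; apply/quot_eqP; apply: cong_sym.
by apply: cong_mul; apply: repr_cong.
Qed.

Lemma quot1 : \pi_quot 1 = 1.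
Proof. by rewrite [RHS]/one /= /quot_one -lock. Qed.

Lemma quot_starE a : \pi_quot a^[*] = (\pi_quot a)^[*].
Proof.
rewrite [RHS]/star /= /quot_star -lock; apply/quot_eqP; apply: cong_sym.
by apply: cong_star; apply: repr_cong.
Qed.

Lemma quot_plusE a : \pi_quot a^[+] = (\pi_quot a)^[+].
Proof.
rewrite [RHS]/plus /= /quot_plus -lock; apply/quot_eqP; apply: cong_sym.
by apply: cong_plus; apply: repr_cong.
Qed.

Lemma quot_generated (Y : Type) (i : Y -> S) :
  birestr_generated i -> birestr_generated (fun y => \pi_quot (i y)).
Proof.
move=> gen_i P [P1 PM Pstar Pplus] Pi; apply: quotW.
apply: (gen_i (fun s => P (\pi_quot s))) => //; split.
- by rewrite quot1.
- by move=> x y Px Py; rewrite quotM; apply: PM.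
- by move=> x Px; rewrite quot_starE; apply: Pstar.
- by move=> x Px; rewrite quot_plusE; apply: Pplus.
Qed.

End Quotient.

Section QuotientMonoid.
Variables (S : birestrMonoidType) (R : S -> S -> Prop).
Local Notation Q := (quot R).
Local Notation qE := (=^~ quotM, =^~ quot1, =^~ quot_starE, =^~ quot_plusE).

Fact quot_mulgA : associative (@mul Q).
Proof. by do 3![elim/quotW => ?]; rewrite !qE mulgA. Qed.
Fact quot_mul1g : left_id 1 (@mul Q).
Proof. by elim/quotW => ?; rewrite !qE mul1g. Qed.
Fact quot_mulg1 : right_id 1 (@mul Q).
Proof. by elim/quotW => ?; rewrite !qE mulg1. Qed.

HB.instance Definition _ := Magma_isSemigroup.Build Q quot_mulgA.
HB.instance Definition _ := BaseUMagma_isUMagma.Build Q quot_mul1g quot_mulg1.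

Fact quot_mul_star (x : Q) : x * x^[*] = x.
Proof. by elim/quotW: x => ?; rewrite !qE mul_star. Qed.
Fact quot_starC (x y : Q) : x^[*] * y^[*] = y^[*] * x^[*].
Proof. by elim/quotW: x => ?; elim/quotW: y => ?; rewrite !qE starC. Qed.
Fact quot_star_mul_star (x y : Q) : (x * y^[*])^[*] = x^[*] * y^[*].
Proof. by elim/quotW: x => ?; elim/quotW: y => ?; rewrite !qE star_mul_star. Qed.
Fact quot_star_ample (x y : Q) : x^[*] * y = y * (x * y)^[*].
Proof. by elim/quotW: x => ?; elim/quotW: y => ?; rewrite !qE star_ample. Qed.
Fact quot_plus_mul (x : Q) : x^[+] * x = x.
Proof. by elim/quotW: x => ?; rewrite !qE plus_mul. Qed.
Fact quot_plusC (x y : Q) : x^[+] * y^[+] = y^[+] * x^[+].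
Proof. by elim/quotW: x => ?; elim/quotW: y => ?; rewrite !qE plusC. Qed.
Fact quot_plus_mul_plus (x y : Q) : (x^[+] * y)^[+] = x^[+] * y^[+].
Proof. by elim/quotW: x => ?; elim/quotW: y => ?; rewrite !qE plus_mul_plus. Qed.
Fact quot_plus_ample (x y : Q) : x * y^[+] = (x * y)^[+] * x.
Proof. by elim/quotW: x => ?; elim/quotW: y => ?; rewrite !qE plus_ample. Qed.
Fact quot_plus_star (x : Q) : (x^[+])^[*] = x^[+].
Proof. by elim/quotW: x => ?; rewrite !qE plus_star. Qed.
Fact quot_star_plus (x : Q) : (x^[*])^[+] = x^[*].
Proof. by elim/quotW: x => ?; rewrite !qE star_plus. Qed.

HB.instance Definition _ := Monoid_isBirestr.Build Q
  quot_mul_star quot_starC quot_star_mul_star quot_star_ample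
  quot_plus_mul quot_plusC quot_plus_mul_plus quot_plus_ample
  quot_plus_star quot_star_plus.

End QuotientMonoid.

Section FreeBirestr.
Variable Y : Type.

Inductive bterm : Type :=
| TVar of Y
| TOne
| TMul of bterm & bterm
| TStar of bterm
| TPlus of bterm.

HB.instance Definition _ := gen_eqMixin bterm.
HB.instance Definition _ := gen_choiceMixin bterm.
HB.instance Definition _ := hasMul.Build bterm TMul.
HB.instance Definition _ := hasOne.Build bterm TOne.
HB.instance Definition _ := hasStarPlus.Build bterm TStar TPlus.

Inductive birestr_law : bterm -> bterm -> Prop :=
| law_mulgA x y z : birestr_law (x * (y * z)) (x * y * z)
| law_mul1g x : birestr_law (1 * x) x
| law_mulg1 x : birestr_law (x * 1) x
| law_mul_star x : birestr_law (x * x^[*]) x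
| law_starC x y : birestr_law (x^[*] * y^[*]) (y^[*] * x^[*])
| law_star_mul_star x y : birestr_law (x * y^[*])^[*] (x^[*] * y^[*])
| law_star_ample x y : birestr_law (x^[*] * y) (y * (x * y)^[*])
| law_plus_mul x : birestr_law (x^[+] * x) x
| law_plusC x y : birestr_law (x^[+] * y^[+]) (y^[+] * x^[+])
| law_plus_mul_plus x y : birestr_law (x^[+] * y)^[+] (x^[+] * y^[+])
| law_plus_ample x y : birestr_law (x * y^[+]) ((x * y)^[+] * x)
| law_plus_star x : birestr_law (x^[+])^[*] x^[+]
| law_star_plus x : birestr_law (x^[*])^[+] x^[*].

Definition free_birestr := quot birestr_law.
Local Notation F := free_birestr.
HB.instance Definition _ := BirestrSig.on F.

Local Notation qE := (=^~ quotM, =^~ quot1, =^~ quot_starE, =^~ quot_plusE).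

Fact free_mulgA : associative (@mul F).
Proof.
do 3![elim/quotW => ?]; rewrite !qE; apply/quot_eqP; apply: cong_base.
exact: law_mulgA.
Qed.
Fact free_mul1g : left_id 1 (@mul F).
Proof.
elim/quotW => ?; rewrite !qE; apply/quot_eqP; apply: cong_base.
exact: law_mul1g.
Qed.
Fact free_mulg1 : right_id 1 (@mul F).
Proof.
elim/quotW => ?; rewrite !qE; apply/quot_eqP; apply: cong_base.
exact: law_mulg1.
Qed.

HB.instance Definition _ := Magma_isSemigroup.Build F free_mulgA.
HB.instance Definition _ := BaseUMagma_isUMagma.Build F free_mul1g free_mulg1.

Fact free_mul_star (x : F) : x * x^[*] = x.
Proof.
elim/quotW: x => ?; rewrite !qE; apply/quot_eqP; apply: cong_base.
exact: law_mul_star.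
Qed.
Fact free_starC (x y : F) : x^[*] * y^[*] = y^[*] * x^[*].
Proof.
elim/quotW: x => ?; elim/quotW: y => ?; rewrite !qE.
by apply/quot_eqP; apply: cong_base; apply: law_starC.
Qed.
Fact free_star_mul_star (x y : F) : (x * y^[*])^[*] = x^[*] * y^[*].
Proof.
elim/quotW: x => ?; elim/quotW: y => ?; rewrite !qE.
by apply/quot_eqP; apply: cong_base; apply: law_star_mul_star.
Qed.
Fact free_star_ample (x y : F) : x^[*] * y = y * (x * y)^[*].
Proof.
elim/quotW: x => ?; elim/quotW: y => ?; rewrite !qE.
by apply/quot_eqP; apply: cong_base; apply: law_star_ample.
Qed.
Fact free_plus_mul (x : F) : x^[+] * x = x.
Proof.
elim/quotW: x => ?; rewrite !qE; apply/quot_eqP; apply: cong_base.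
exact: law_plus_mul.
Qed.
Fact free_plusC (x y : F) : x^[+] * y^[+] = y^[+] * x^[+].
Proof.
elim/quotW: x => ?; elim/quotW: y => ?; rewrite !qE.
by apply/quot_eqP; apply: cong_base; apply: law_plusC.
Qed.
Fact free_plus_mul_plus (x y : F) : (x^[+] * y)^[+] = x^[+] * y^[+].
Proof.
elim/quotW: x => ?; elim/quotW: y => ?; rewrite !qE.
by apply/quot_eqP; apply: cong_base; apply: law_plus_mul_plus.
Qed.
Fact free_plus_ample (x y : F) : x * y^[+] = (x * y)^[+] * x.
Proof.
elim/quotW: x => ?; elim/quotW: y => ?; rewrite !qE.
by apply/quot_eqP; apply: cong_base; apply: law_plus_ample.
Qed.
Fact free_plus_star (x : F) : (x^[+])^[*] = x^[+].
Proof.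
elim/quotW: x => ?; rewrite !qE; apply/quot_eqP; apply: cong_base.
exact: law_plus_star.
Qed.
Fact free_star_plus (x : F) : (x^[*])^[+] = x^[*].
Proof.
elim/quotW: x => ?; rewrite !qE; apply/quot_eqP; apply: cong_base.
exact: law_star_plus.
Qed.

HB.instance Definition _ := Monoid_isBirestr.Build F
  free_mul_star free_starC free_star_mul_star free_star_ample
  free_plus_mul free_plusC free_plus_mul_plus free_plus_ample
  free_plus_star free_star_plus.

Definition free_gen (y : Y) : F := \pi_(quot birestr_law) (TVar y).

Lemma free_generated : birestr_generated free_gen.
Proof.
apply: quot_generated => P [P1 PM Pstar Pplus] PV.
by elim=> [y||a Pa b Pb|a Pa|a Pa];
  [apply: PV|apply: P1|apply: PM|apply: Pstar|apply: Pplus].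
Qed.

Section Presentation.
Variable R : free_birestr -> free_birestr -> Prop.

Definition presented : Type := quot R.
HB.instance Definition _ := BirestrMonoid.on presented.

Definition presented_gen (y : Y) : presented := \pi_(quot R) (free_gen y).

Lemma presented_generated : birestr_generated presented_gen.
Proof. exact: quot_generated free_generated. Qed.

Definition BRestr : genBirestr Y := GenBirestr presented_generated.

End Presentation.

End FreeBirestr.

Definition idempotent (M : monoidType) (e : M) : Prop := e * e = e.

Definition is_inverse (M : monoidType) (a b : M) : Prop :=
  a * b * a = a /\ b * a * b = b.

(* The involution laws of a *-monoid follow from existence and uniqueness of
   inverses: see the factory Monoid_isInverse below. *)
HB.mixin Record StarMonoid_isInverse M of StarMonoid M := {
  invg_is_inverse : forall a : M, is_inverse a a^-1;
  inverse_unique : forall a b : M, is_inverse a b -> b = a^-1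
}.

#[short(type="inverseMonoidType")]
HB.structure Definition InverseMonoid :=
  {M of StarMonoid_isInverse M & StarMonoid M}.

Bind Scope group_scope with InverseMonoid.sort.

Section UniqueInverses.
Variables (M : monoidType) (V : M -> M).
Hypothesis VP : forall a, is_inverse a (V a).
Hypothesis VU : forall a b, is_inverse a b -> b = V a.
Implicit Types a b e f : M.

Lemma uinvK : involutive V.
Proof. by move=> a; apply/esym/VU; case: (VP a). Qed.

Lemma uinv_idem e : idempotent e -> V e = e.
Proof. by move=> ee; apply/esym/VU; split; rewrite !ee. Qed.

Lemma uinv_idemM e f : idempotent e -> idempotent f -> idempotent (e * f).
Proof.
move=> ee ff; case: (VP (e * f)); set x := V (e * f) => x1 x2.
have xE : f * x * e = x.
  apply: VU; split.
    by rewrite -[RHS]x1 !mulgA -(mulgA e f f) ff -(mulgA _ e e) ee.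
  by rewrite -[in RHS]x2 !mulgA -(mulgA _ e e) ee -(mulgA _ f f) ff.
have xx : idempotent x.
  rewrite /idempotent -[in LHS]xE.
  have -> : f * x * e * (f * x * e) = f * (x * (e * f) * x) * e.
    by rewrite !mulgA.
  by rewrite x2.
by have <- : x = e * f by rewrite -[RHS]uinvK -/x uinv_idem.
Qed.

Lemma uinv_idemC e f : idempotent e -> idempotent f -> e * f = f * e.
Proof.
move=> ee ff; have Eef := uinv_idemM ee ff; have Efe := uinv_idemM ff ee.
rewrite -[RHS]uinv_idem //; apply: VU; split.
  by rewrite -[RHS]Efe !mulgA -(mulgA f e e) ee -(mulgA _ f f) ff.
by rewrite -[RHS]Eef !mulgA -(mulgA e f f) ff -(mulgA _ e e) ee.
Qed.

Lemma uinv_idemr a : idempotent (a * V a).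
Proof. by rewrite /idempotent mulgA; case: (VP a) => ->. Qed.

Lemma uinv_ideml a : idempotent (V a * a).
Proof. by rewrite /idempotent mulgA; case: (VP a) => _ ->. Qed.

Lemma uinvM a b : V (a * b) = V b * V a.
Proof.
have C := uinv_idemC (uinv_idemr b) (uinv_ideml a).
have [a1 a2] := VP a; have [b1 b2] := VP b.
apply/esym/VU; split.
  have -> : a * b * (V b * V a) * (a * b) = a * (b * V b * (V a * a)) * b.
    by rewrite !mulgA.
  have -> : a * (b * V b * (V a * a)) * b = (a * V a * a) * (b * V b * b).
    by rewrite C !mulgA.
  by rewrite a1 b1.
have -> : V b * V a * (a * b) * (V b * V a) = V b * (V a * a * (b * V b)) * V a.
  by rewrite !mulgA.
have -> : V b * (V a * a * (b * V b)) * V a = (V b * b * V b) * (V a * a * V a).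
  by rewrite -C !mulgA.
by rewrite a2 b2.
Qed.

End UniqueInverses.

HB.factory Record Monoid_isInverse M of Monoid M := {
  inv : M -> M;
  inv_is_inverse : forall a : M, is_inverse a (inv a);
  inv_unique : forall a b : M, is_inverse a b -> b = inv a
}.

HB.builders Context M of Monoid_isInverse M.
HB.instance Definition _ := hasInv.Build M inv.
HB.instance Definition _ := Monoid_isStarMonoid.Build M
  (uinvK inv_is_inverse inv_unique) (uinvM inv_is_inverse inv_unique).
HB.instance Definition _ :=
  StarMonoid_isInverse.Build M inv_is_inverse inv_unique.
HB.end.

(* An inverse monoid regarded as a birestriction monoid. *)
Definition inv_birestr (M : inverseMonoidType) : Type := M.

Section InverseBirestr.
Variable M : inverseMonoidType.
Local Notation B := (inv_birestr M).

HB.instance Definition _ := InverseMonoid.on B.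
HB.instance Definition _ :=
  hasStarPlus.Build B (fun a : B => a^-1 * a) (fun a : B => a * a^-1).

Implicit Types a b : B.

Let idemC (e f : B) : idempotent e -> idempotent f -> e * f = f * e.
Proof. exact: uinv_idemC invg_is_inverse inverse_unique e f. Qed.
Let idemV (e : B) : idempotent e -> e^-1 = e.
Proof. exact: uinv_idem inverse_unique e. Qed.
Let idem_star a : idempotent (a^[*]).
Proof. exact: uinv_ideml invg_is_inverse a. Qed.
Let idem_plus a : idempotent (a^[+]).
Proof. exact: uinv_idemr invg_is_inverse a. Qed.
Let starV a : (a^[*])^-1 = a^[*]. Proof. exact: idemV. Qed.
Let plusV a : (a^[+])^-1 = a^[+]. Proof. exact: idemV. Qed.

Fact inv_mul_star a : a * a^[*] = a.
Proof. by rewrite [LHS]mulgA; case: (invg_is_inverse a). Qed.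
Fact inv_starC a b : a^[*] * b^[*] = b^[*] * a^[*].
Proof. exact: idemC. Qed.
Fact inv_star_ample a b : a^[*] * b = b * (a * b)^[*].
Proof.
rewrite /star /= invgM !mulgA -(mulgA _ a^-1 a) -(mulgA b).
have := idemC (idem_plus b) (idem_star a); rewrite /star /plus /= => C.
by rewrite mulgA C -(mulgA _ (b * b^-1)); case: (invg_is_inverse b) => ->.
Qed.
Fact inv_star_mul_star a b : (a * b^[*])^[*] = a^[*] * b^[*].
Proof.
rewrite [LHS]/star /= invgM starV.
rewrite -(mulgA b^[*]) (mulgA a^-1) mulgA.
rewrite -/(a^[*]) (inv_starC b a).
by rewrite -[LHS]mulgA idem_star.
Qed.
Fact inv_plus_mul a : a^[+] * a = a.
Proof. by case: (invg_is_inverse a). Qed.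
Fact inv_plusC a b : a^[+] * b^[+] = b^[+] * a^[+].
Proof. exact: idemC. Qed.
Fact inv_plus_mul_plus a b : (a^[+] * b)^[+] = a^[+] * b^[+].
Proof.
rewrite [LHS]/plus /= invgM plusV.
rewrite -(mulgA a^[+]) (mulgA b) -/(b^[+]) (inv_plusC b a) mulgA.
by rewrite idem_plus.
Qed.
Fact inv_plus_ample a b : a * b^[+] = (a * b)^[+] * a.
Proof.
rewrite /plus /= invgM -!mulgA.
have := idemC (idem_star a) (idem_plus b); rewrite /star /plus /= => C.
by rewrite (mulgA b b^-1) -C !mulgA; case: (invg_is_inverse a) => ->.
Qed.
Fact inv_plus_star a : (a^[+])^[*] = a^[+].
Proof. by rewrite [LHS]/star /= plusV idem_plus. Qed.
Fact inv_star_plus a : (a^[*])^[+] = a^[*].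
Proof. by rewrite [LHS]/plus /= starV idem_star. Qed.

HB.instance Definition _ := Monoid_isBirestr.Build B
  inv_mul_star inv_starC inv_star_mul_star inv_star_ample
  inv_plus_mul inv_plusC inv_plus_mul_plus inv_plus_ample
  inv_plus_star inv_star_plus.

End InverseBirestr.

Definition E_unitary (M : inverseMonoidType) : Prop :=
  forall s e : inv_birestr M, idempotent e -> natge s e -> idempotent s.

Record inverse_closed (M : inverseMonoidType) (P : M -> Prop) : Prop :=
  InverseClosed {
    inverse_closed1 : P 1;
    inverse_closedM : forall x y, P x -> P y -> P (x * y);
    inverse_closedV : forall x, P x -> P x^-1
  }.

Definition inverse_generated (Y : Type) (M : inverseMonoidType) (j : Y -> M) :=
  forall P : M -> Prop, inverse_closed P -> (forall y, P (j y)) -> forall s, P s.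

Definition admits_geometric_model (Y : Type) (S : genBirestr Y) : Prop :=
  exists (M : inverseMonoidType) (j : Y -> M) (f : S -> inv_birestr M),
    [/\ E_unitary M,
        inverse_generated j,
        birestr_morphism f,
        injective f &
        forall y, f (assign S y) = j y].

Section FVoid.
Variable X : Type.

(* The free semigroup on X: nonempty words. *)
Definition word : Type := {s : seq X | ~~ nilp s}.

Definition letter (x : X) : word := exist _ [:: x] isT.

Fact word_cat_subproof (u v : word) : ~~ nilp (sval u ++ sval v).
Proof. by case: u => -[]. Qed.

Definition word_cat (u v : word) : word :=
  exist _ (sval u ++ sval v) (word_cat_subproof u v).

(* Y is the disjoint union of X and a copy of the set of words. *)
Local Notation Y := (X + word)%type.

Definition gen_letter (x : X) : free_birestr Y := free_gen (inl x).
Definition gen_bar (u : word) : free_birestr Y := free_gen (inr u).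

Inductive FVoid_ge : free_birestr Y -> free_birestr Y -> Prop :=
| FVoid_letter x : FVoid_ge (gen_bar (letter x)) (gen_letter x)
| FVoid_cat u v : FVoid_ge (gen_bar (word_cat u v)) (gen_bar u * gen_bar v).

Definition FVoid : genBirestr Y := BRestr (natge_rel FVoid_ge).

End FVoid.

(* Main.v *)
From HB Require Import structures.
From mathcomp Require Import all_boot boolp.
Require Import Defs.

(** Write [a] and [b] for the generators of the words [x] and [xx].  In an
    E-unitary inverse monoid [b >= a a] makes [a^-1 b a^-1] lie above an
    idempotent, so it is idempotent itself, and this forces the projection
    [a^+ (b a^-1 a)^+] below [(a a)^+]: arrows [0 -a-> 1'], [0 -b-> 2] and
    [1 -a-> 2] with weights 1, 2, 1 embed into the integers only if [1 = 1'].
    The presentation does not force this inequality: read as partial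
    bijections of a four-element set, these three arrows satisfy the
    defining relations, although no two of them compose. *)

Set Implicit Arguments.
Unset Strict Implicit.
Unset Printing Implicit Defensive.

Local Open Scope group_scope.
Local Open Scope quotient_scope.

(** * Universal properties of quotients, free birestriction monoids and presentations *)

Lemma quot_lift (S T : birestrSigType) (R : S -> S -> Prop) (h : S -> T) :
    birestr_morphism h -> (forall a b, R a b -> h a = h b) ->
  exists2 g : quot R -> T,
    birestr_morphism g & forall a, g (\pi_(quot R) a) = h a.
Proof.
move=> [[h1 hM] hS hP] hR.
(* Having equal images under [h] is a congruence containing [R], so it contains the generated one
   and [h] may be evaluated on representatives. *)
have hcong a b : cong_gen R a b -> h a = h b.
  elim=> {a b} [//|//|//|a b c _ -> _ -> //|a a' b b' _ Ea _ Eb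
    |a a' _ E|a a' _ E].
  - by rewrite !hM Ea Eb.
  - by rewrite !hS E.
  - by rewrite !hP E.
pose g (q : quot R) := h (repr q).
have gpi a : g (\pi_(quot R) a) = h a by apply/hcong/repr_cong.
exists g => //; split; first split.
- by rewrite -quot1 gpi.
- by elim/quotW=> a; elim/quotW=> b; rewrite -quotM !gpi hM.
- by elim/quotW=> a; rewrite -quot_starE !gpi hS.
- by elim/quotW=> a; rewrite -quot_plusE !gpi hP.
Qed.

Lemma free_lift (Y : Type) (T : birestrMonoidType) (i : Y -> T) :
  exists2 g : free_birestr Y -> T,
    birestr_morphism g & forall y, g (free_gen y) = i y.
Proof.
pose fix ev (t : bterm Y) : T :=
  match t with
  | TVar y => i y
  | TOne => 1
  | TMul s t => ev s * ev t
  | TStar t => (ev t)^[*]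
  | TPlus t => (ev t)^[+]
  end.
have [||g gM gE] := @quot_lift (bterm Y) T (@birestr_law Y) ev.
- by [].
- move=> s t [] * /=.
  + exact: mulgA.
  + exact: mul1g.
  + exact: mulg1.
  + exact: mul_star.
  + exact: starC.
  + exact: star_mul_star.
  + exact: star_ample.
  + exact: plus_mul.
  + exact: plusC.
  + exact: plus_mul_plus.
  + exact: plus_ample.
  + exact: plus_star.
  + exact: star_plus.
by exists g => // y; apply: gE.
Qed.

Lemma natge_morph (S T : birestrSigType) (f : S -> T) (a b : S) :
  birestr_morphism f -> natge a b -> natge (f a) (f b).
Proof. by case=> -[_ fM] fS _ E; rewrite /natge -fS -fM -E. Qed.

Lemma BRestr_lift (Y : Type) (G : free_birestr Y -> free_birestr Y -> Prop)
    (T : birestrMonoidType) (h : free_birestr Y -> T) :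
    birestr_morphism h -> (forall a b, G a b -> natge (h a) (h b)) ->
  exists2 g : BRestr (natge_rel G) -> T,
    birestr_morphism g & forall a, g (\pi_(quot (natge_rel G)) a) = h a.
Proof.
move=> hM hG; apply: quot_lift => // _ _ [a b /hG E].
by case: hM => -[_ hM] hS _; rewrite hM hS -E.
Qed.

Lemma BRestr_natge (Y : Type) (G : free_birestr Y -> free_birestr Y -> Prop)
    (a b : free_birestr Y) :
  G a b ->
  natge (\pi_(quot (natge_rel G)) a) (\pi_(quot (natge_rel G)) b).
Proof.
move=> Gab; rewrite /natge -quot_starE -quotM.
by apply/quot_eqP/cong_base.
Qed.

(** * An identity forced by E-unitarity *)

Lemma E_unitary_square (M : inverseMonoidType) (a b : inv_birestr M) :
    E_unitary M -> natge b (a * a) ->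
  (a * a)^[+] * (a^[+] * (b * a^[*])^[+]) = a^[+] * (b * a^[*])^[+].
Proof.
move=> EU baa.
have invP := @invg_is_inverse M; have invU := @inverse_unique M.
pose s : inv_birestr M := a^-1 * b * a^-1.
have ss : idempotent s.
  (* This idempotent is [a^-1 a a a^-1]; writing [a a] as [b (a a)^*] turns it into [s] times
     itself, which is what lying below [s] means. *)
  have ee : idempotent (a^[*] * a^[+]).
    apply: (uinv_idemM invP invU); first exact: (uinv_ideml invP).
    exact: (uinv_idemr invP).
  apply: (EU s (a^[*] * a^[+])) => //.
  have eS : (a^[*] * a^[+])^[*] = a^[*] * a^[+].
    by rewrite {1}/star /= (uinv_idem invU ee) ee.
  rewrite /natge eS; apply/esym.
  transitivity (a^-1 * (b * (a * a)^[*]) * a^-1 : inv_birestr M).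
    by rewrite /s /star /plus /= invgM !mulgA.
  by rewrite -baa /star /plus /= !mulgA.
have sV : s^-1 = s by exact: (uinv_idem invU).
have sE : s = a * b^-1 * a by rewrite -sV /s !invgM !invgK mulgA.
have VK (t : M) : t * a^-1 * a * a^-1 = t * a^-1.
  by rewrite -2!mulgA (mulgA a^-1) (invP a).2.
(* Since projections commute, the left side is [a s s^-1 a^-1], hence [a s a^-1]. Replacing [s] by
   [a b^-1 a] then exposes the left factor [a a], which [(a a)^+] fixes. *)
have projE : a^[+] * (b * a^[*])^[+] = a * a * (b^-1 * a^[+]).
  transitivity (a^[+] * (b * a^[*])^[+] * a^[+]).
    rewrite -[RHS]mulgA (plusC (b * _)) [RHS]mulgA.
    by rewrite [a^[+] * a^[+]](uinv_idemr invP).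
  transitivity (a * (s * s^-1) * a^-1 : inv_birestr M); last first.
    by rewrite sV ss sE /plus /= !mulgA.
  by rewrite /s /star /plus /= !invgM !invgK !mulgA VK.
by rewrite projE mulgA plus_mul.
Qed.

(** * The symmetric inverse monoid on a set *)

Section PartialBijection.
Variable V : Type.

(** Relations are used instead of partial functions so that inversion is the converse, which merely
    swaps the two conditions. *)
Record pbij : Type := Pbij {
  pbij_rel :> V -> V -> Prop;
  pbij_fun : forall u v w, pbij_rel u v -> pbij_rel u w -> v = w;
  pbij_inj : forall u v w, pbij_rel u w -> pbij_rel v w -> u = v
}.

Implicit Types r s t : pbij.

Lemma pbij_ext r s : (forall u v, r u v <-> s u v) -> r = s.
Proof.
case: r s => [r rf ri] [s sf si] /= rs.
have E : r = s by apply/funext=> u; apply/funext=> v; apply/propext.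
by case: _ / E in sf si *; congr Pbij; apply: Prop_irrelevance.
Qed.

Definition pbij_one : pbij.
Proof. by exists (fun u v => u = v) => [u v w <-|u v w ->]. Defined.

Definition rel_comp r s u w := exists2 v, r u v & s v w.

Fact rel_comp_fun r s u v w : rel_comp r s u v -> rel_comp r s u w -> v = w.
Proof.
move=> [p rup spv] [q ruq sqw].
by case: _ / (pbij_fun rup ruq) in sqw; apply: pbij_fun spv sqw.
Qed.

Fact rel_comp_inj r s u v w : rel_comp r s u w -> rel_comp r s v w -> u = v.
Proof.
move=> [p rup spw] [q rvq sqw].
by case: _ / (pbij_inj spw sqw) in rvq; apply: pbij_inj rup rvq.
Qed.

Definition pbij_mul r s : pbij := Pbij (@rel_comp_fun r s) (@rel_comp_inj r s).

Definition pbij_inv r : pbij :=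
  @Pbij (fun u v => r v u) (fun u v w => @pbij_inj r v w u)
    (fun u v w => @pbij_fun r w u v).

HB.instance Definition _ := gen_eqMixin pbij.
HB.instance Definition _ := gen_choiceMixin pbij.
HB.instance Definition _ := hasMul.Build pbij pbij_mul.
HB.instance Definition _ := hasOne.Build pbij pbij_one.

Fact pbij_mulA : associative (@mul pbij).
Proof.
move=> r s t; apply: pbij_ext => u v; split.
- by case=> p rup [q spq tqv]; exists q => //; exists p.
- by case=> q [p rup spq] tqv; exists p => //; exists q.
Qed.
Fact pbij_mul1g : left_id 1 (@mul pbij).
Proof. by move=> r; apply: pbij_ext => u v; split=> [[_ <-]|]; last exists u. Qed.
Fact pbij_mulg1 : right_id 1 (@mul pbij).
Proof. by move=> r; apply: pbij_ext => u v; split=> [[w ? <-]|]; last exists v. Qed.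

HB.instance Definition _ := Magma_isSemigroup.Build pbij pbij_mulA.
HB.instance Definition _ := BaseUMagma_isUMagma.Build pbij pbij_mul1g pbij_mulg1.

Fact pbij_inv_is_inverse r : is_inverse r (pbij_inv r).
Proof.
split; apply: pbij_ext => u v; split=> [[w [p up pw] wv]|uv].
- by rewrite (pbij_inj up pw).
- by exists u => //; exists v.
- by have := @pbij_fun r _ _ _ up pw => ->.
- by exists u => //; exists v.
Qed.

(** If [q p q = q], then [q] is contained in the converse of [p]; the two identities of an inverse
    pair give the two inclusions. *)
Fact pbij_inv_unique r s : is_inverse r s -> s = pbij_inv r.
Proof.
have sub (p q : pbij) : q * p * q = q -> forall u v, q u v -> p v u.
  move=> E u v quv; have: (q * p * q)%g u v by rewrite E.
  case=> w [z quz pzw] qwv.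
  by rewrite (pbij_fun quv quz) (pbij_inj quv qwv).
case=> rsr srs; apply: pbij_ext => u v; split.
- exact: (sub _ _ srs u v).
- exact: (sub _ _ rsr v u).
Qed.

HB.instance Definition _ :=
  Monoid_isInverse.Build pbij pbij_inv_is_inverse pbij_inv_unique.

Definition pbij0 : pbij.
Proof. by exists (fun _ _ => False). Defined.

Lemma mul_pbij0 r : pbij0 * r = pbij0.
Proof. by apply: pbij_ext => u v; split=> // -[]. Qed.

(** In the model below, the smaller side of each defining relation is sent to zero, so this verifies
    all of them. *)
Lemma natge_pbij0 (r s : inv_birestr pbij) : s = pbij0 -> natge r s.
Proof.
by move=> ->; apply: pbij_ext => u v; split=> // -[w _ [? []]].
Qed.

End PartialBijection.

(** * The four-point model and the contradiction *)

(* The points 0, 1, 2, 3 are the vertices 0, 1, 2, 1' of the header. *)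
Definition arrow (n i j : nat) : Prop :=
  (match n with
  | 1 => i = 0 /\ j = 3 \/ i = 1 /\ j = 2
  | 2 => i = 0 /\ j = 2
  | _ => False
  end)%N.

Fact arrow_fun n u v w : arrow n u v -> arrow n u w -> v = w.
Proof. by case: n => [|[|[|n]]] //=; intuition congruence. Qed.

Fact arrow_inj n u v w : arrow n u w -> arrow n v w -> u = v.
Proof. by case: n => [|[|[|n]]] //=; intuition congruence. Qed.

Definition arrows n : inv_birestr (pbij nat) :=
  Pbij (@arrow_fun n) (@arrow_inj n).

(** Arrows start in 0 or 1 and end in 2 or 3. *)
Lemma arrowsM m n : arrows m * arrows n = pbij0 nat.
Proof.
apply: pbij_ext => u w; split=> // -[v].
by case: m n => [|[|[|m]]] [|[|[|n]]] //=; intuition congruence.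
Qed.

Theorem proposition11p2 (X : Type) (x : X) (hX : forall y : X, y = x) :
  ~ admits_geometric_model (FVoid X).
Proof.
case=> M [j [f [EU _ fM finj _]]].
pose pi := \pi_(quot (natge_rel (@FVoid_ge X))).
pose a : FVoid X := pi (gen_bar (letter x)).
pose b : FVoid X := pi (gen_bar (word_cat (letter x) (letter x))).
have baa : natge b (a * a).
  by rewrite /a /b -quotM; apply: BRestr_natge; constructor.
(* The identity holds for the images in [M]; injectivity of [f] pulls it back to the presented
   monoid. *)
have eqF : (a * a)^[+] * (a^[+] * (b * a^[*])^[+]) = a^[+] * (b * a^[*])^[+].
  have := natge_morph fM baa; case: fM => -[_ fM] fS fP.
  rewrite fM => /(E_unitary_square EU) E.
  by apply: finj; rewrite !(fM, fS, fP).
(* Letters act as zero and barred words through their length, so that both [x] and every product of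
   two barred words vanish. *)
pose i (y : X + word X) : inv_birestr (pbij nat) :=
  match y with inl _ => pbij0 nat | inr u => arrows (size (sval u)) end.
have [h hM hE] := free_lift i.
have [|g [[_ gM] gS gP] gE] := @BRestr_lift _ (@FVoid_ge X) _ h hM.
  move=> _ _ [y|u v]; apply: natge_pbij0; first exact: hE.
  by case: hM => -[_ ->] _ _; rewrite !hE arrowsM.
have ga : g a = arrows 1%N by rewrite gE hE.
have gb : g b = arrows 2%N by rewrite gE hE.
have := congr1 g eqF; rewrite !(gM, gS, gP) ga gb arrowsM.
set r := _ * _; set p := (X in _ = X) => E.
have r0 : r = pbij0 nat by rewrite /r /plus /= !mul_pbij0.
have : p 0%N 0%N.
  (* The point 0 is fixed: [a] leads to 3 and back, while [b] leads to 2, where [a^*] is defined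
     thanks to the arrow from 1, and back. *)
  exists 0%N; first by exists 3%N; left.
  exists 2%N; last by exists 2%N => //; exists 1%N; right.
  by exists 2%N => //; exists 1%N; right.
by rewrite -E r0.
Qed.
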